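(* For every integer $t\geq 1$, every graph that does not contain $K_t$ as an immersion is $2$-colourable with defect $(t-1)^3$.
   Context: All graphs are finite and simple. A graph $G$ contains $H$ as an immersion if the vertices of $H$ can be mapped to distinct vertices of $G$ and the edges of $H$ to pairwise edge-disjoint paths in $G$ such that each edge $vw$ of $H$ is mapped to a path whose endpoints are the images of $v$ and $w$. A graph is $k$-colourable with defect $d$ if its vertices can be given one of $k$ colours (not necessarily properly) so that each vertex has at most $d$ neighbours of its own colour. *)

(* Defs.v *)
From mathcomp Require Import all_boot.
Set Implicit Arguments.
Unset Strict Implicit.
Unset Printing Implicit Defensive.

Record sgraph := SGraph {
  vertex :> finType;
  adj : rel vertex;
  adj_sym : symmetric adj;
  adj_irr : irreflexive adj
}.

Definition edges (G : sgraph) : {set {set G}} :=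
  [set [set p.1; p.2] | p : G * G & adj p.1 p.2].

Definition complete_rel (t : nat) : rel 'I_t := fun i j => i != j.

Lemma complete_sym t : symmetric (@complete_rel t).
Proof. by move=> i j; rewrite /complete_rel eq_sym. Qed.

Lemma complete_irr t : irreflexive (@complete_rel t).
Proof. by move=> i; rewrite /complete_rel eqxx. Qed.

Definition complete_graph (t : nat) : sgraph :=
  SGraph (@complete_sym t) (@complete_irr t).

(* A path is the nonempty, repetition-free sequence of its vertices, both
   endpoints included. *)
Definition is_path (G : sgraph) (s : seq G) : bool :=
  if s is x :: p then path (@adj G) x p && uniq s else false.

Definition path_edges (G : sgraph) (s : seq G) : seq {set G} :=
  [seq [set e.1; e.2] | e <- zip s (behead s)].

Definition endpoints (G : sgraph) (s : seq G) : {set G} :=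
  if s is x :: p then [set x; last x p] else set0.

(* [P] is indexed by unordered edges [e] of [H]; only its values on [edges H]
   matter. For [e = [set v; w]], the set [phi @: e] is [[set phi v; phi w]].
   The paths may pass through images of other vertices of [H]. *)
Definition immersion (H G : sgraph) : Prop :=
  exists (phi : H -> G) (P : {set H} -> seq G),
    [/\ injective phi,
        forall e, e \in edges H -> is_path (P e) /\ endpoints (P e) = phi @: e
      & forall e f, e \in edges H -> f \in edges H -> e != f ->
          [disjoint path_edges (P e) & path_edges (P f)]].

Definition colourable_with_defect (k d : nat) (G : sgraph) : Prop :=
  exists c : G -> 'I_k,
    forall v : G, #|[set w | adj v w & c w == c v]| <= d.

(* Main.v *)
(* Let [K = (t - 1) ^ 2].  Call two vertices inseparable if no edge cut of size
   less than [K] separates them.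

   If [t] vertices are pairwise inseparable, Menger's theorem gives, towards one
   of them, [t - 1] paths from each of the others, all edge-disjoint; gluing the
   path of [i] reserved for [j] to that of [j] reserved for [i] yields a [K_t]
   immersion.  So without such an immersion every class of inseparable vertices
   has at most [t - 1] elements.

   Uncrossing minimum cuts (as in a Gomory-Hu tree) ranks the classes so that
   each class [X] lies in a cut [S_X] of size less than [K] which avoids all the
   classes ranked before [X].  Give each class the colour opposite to that of
   its lowest ranked neighbouring class, if that one has lower rank.  If [v] in
   [X] has the same colour as its neighbour [w] outside [X], then either [vw]
   leaves [S_X], or the class of [w] lies in [S_X] and sends an edge to a class
   ranked before [X], hence out of [S_X].  So [v] has at most
   [(t - 1) (K - 1) + (t - 2) <= (t - 1) ^ 3] neighbours of its own colour. *)

Require Import Defs.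
From mathcomp Require Import all_boot.
From mathcomp Require Import zify.

Set Implicit Arguments.
Unset Strict Implicit.
Unset Printing Implicit Defensive.

(** * Routing tokens along arc-disjoint paths *)

Definition out (V : finType) (D : {set V * V}) (S : {set V}) : nat :=
  \sum_(a in D) ((a.1 \in S) && (a.2 \notin S)).

Lemma outE (V : finType) (D : {set V * V}) (S : {set V}) :
  out D S = #|[set a in D | (a.1 \in S) && (a.2 \notin S)]|.
Proof.
rewrite /out big_mkcond -sum1_card [RHS]big_mkcond; apply: eq_bigr => a _.
by rewrite inE; case: (a \in D) => //=; case: (_ && _).
Qed.

Lemma out_submod (V : finType) (D : {set V * V}) (S T : {set V}) :
  out D (S :&: T) + out D (S :|: T) <= out D S + out D T.
Proof.
rewrite /out -!big_split; apply: leq_sum => a _; rewrite !inE.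
by do 4!case: (_ \in _).
Qed.

(** The arc [(x, y)] leaves [S] but neither [S :&: T] nor [S :|: T]. *)
Lemma out_submod_strict (V : finType) (D : {set V * V}) (S T : {set V}) x y :
  (x, y) \in D -> x \in S -> x \notin T -> y \in T -> y \notin S ->
  out D (S :&: T) + out D (S :|: T) < out D S + out D T.
Proof.
move=> xyD xS xT yT yS; rewrite /out -!big_split !(bigD1 (x, y) xyD) /=.
rewrite -addSn leq_add //; first by rewrite !inE xS (negbTE xT) yT (negbTE yS).
apply: leq_sum => a _; rewrite !inE.
by do 4!case: (_ \in _).
Qed.

Lemma outD1 (V : finType) (D : {set V * V}) a (S : {set V}) :
  a \in D -> out D S = ((a.1 \in S) && (a.2 \notin S)) + out (D :\ a) S.
Proof. by move=> aD; rewrite /out (big_setD1 a). Qed.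

(** Token [i] sits at the vertex [b i]; several tokens may share a vertex. *)
Definition load (V I : finType) (b : I -> V) (S : {set V}) : nat :=
  \sum_i (b i \in S).

Lemma load_mod (V I : finType) (b : I -> V) (S T : {set V}) :
  load b (S :&: T) + load b (S :|: T) = load b S + load b T.
Proof.
rewrite /load -!big_split; apply: eq_bigr => i _; rewrite !inE.
by do 2!case: (_ \in _).
Qed.

Lemma loadD1 (V I : finType) (b : I -> V) (S : {set V}) i :
  load b S = (b i \in S) + \sum_(j | j != i) (b j \in S).
Proof. by rewrite /load (bigD1 i). Qed.

(* The cut condition for sending one token from each [b i] to [s]. *)
Definition feasible (V I : finType) (b : I -> V) (s : V) (D : {set V * V}) :=
  [forall S : {set V}, (s \notin S) ==> (load b S <= out D S)].

Lemma feasibleP (V I : finType) (b : I -> V) (s : V) (D : {set V * V}) :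
  reflect (forall S : {set V}, s \notin S -> load b S <= out D S)
          (feasible b s D).
Proof.
apply: (iffP forallP) => H S; first exact: implyP (H S).
by apply/implyP; apply: H.
Qed.

(* In a minimal feasible [D] every arc leaves a tight set; the tight sets for
   two opposite arcs would cross and violate strict submodularity. *)
Lemma feasible_antisym (V I : finType) (b : I -> V) (s : V) (D : {set V * V}) :
  feasible b s D ->
  exists2 D' : {set V * V}, D' \subset D &
    feasible b s D' /\
    forall x y, x != y -> (x, y) \in D' -> (y, x) \notin D'.
Proof.
move=> fD; have [D' /minsetP[fD' minD'] sD'] := minset_exists fD.
exists D' => //; split=> // x y neq_xy xyD; apply/negP => yxD.
have critical a : a \in D' -> exists S : {set V},
    [/\ s \notin S, a.1 \in S, a.2 \notin S & out D' S <= load b S].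
  move=> aD.
  have /forallPn[S] : ~~ feasible b s (D' :\ a).
    apply/negP => fDa; have /setP/(_ a) := minD' _ fDa (subsetDl _ _).
    by rewrite !inE eqxx aD.
  rewrite negb_imply -ltnNge => /andP[sS ltS]; exists S.
  have := feasibleP _ _ _ fD' S sS; rewrite (outD1 S aD).
  by case: (a.1 \in S); case: (a.2 \in S) => /=; rewrite ?sS //; split=> //; lia.
have [S [sS xS yS tS]] := critical _ xyD.
have [T [sT yT xT tT]] := critical _ yxD.
have := out_submod_strict xyD xS xT yT yS.
have := feasibleP _ _ _ fD' (S :&: T); have := feasibleP _ _ _ fD' (S :|: T).
rewrite !inE (negbTE sS) (negbTE sT) => /(_ isT) leU /(_ isT) leI.
by move/(leq_ltn_trans (leq_add leI leU)); rewrite load_mod ltnNge leq_add.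
Qed.

(* Pushing token [i] over the arc [(b i, w)] and deleting that arc fails only if
   [w] is in a tight set avoiding [b i].  If this blocked every [w], the union
   of these tight sets together with [b i] would violate the cut condition. *)
Lemma feasible_push (V I : finType) (b : I -> V) (s : V) (D : {set V * V}) i :
  feasible b s D -> b i != s ->
  exists2 w, (b i, w) \in D &
    feasible (fun j => if j == i then w else b j) s (D :\ (b i, w)).
Proof.
move=> /feasibleP fD bs; set v := b i in bs *.
pose tight (T : {set V}) := [&& s \notin T, v \notin T & out D T == load b T].
have tight0 : tight set0.
  rewrite /tight !inE /=; apply/eqP.
  by rewrite /out /load !big1 // => a _; rewrite !inE.
(* By submodularity, unions of tight sets are tight, so a largest one stands for the union of them
   all. *)
case: (arg_maxnP (fun T : {set V} => #|T|) tight0) => T /and3P[sT vT /eqP tT] maxT.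
have [w vwD wT] : exists2 w, (v, w) \in D & w \notin T.
  apply/exists_inP; apply: contraT => /exists_inPn noout.
  have := fD (v |: T); rewrite !inE negb_or eq_sym bs sT => /(_ isT).
  have : out D (v |: T) <= out D T.
    apply: leq_sum => [[x y]] xyD; rewrite !inE /=.
    have := noout y; case: (eqVneq x v) xyD => [-> vyD /(_ vyD)|_ _ _] /=.
      by rewrite negbK => ->; rewrite orbT.
    by case: (x \in T); case: (y \in T); case: (y == v).
  have : load b T < load b (v |: T).
    rewrite !(loadD1 b _ i) -/v !inE eqxx (negbTE vT) /= add0n add1n ltnS.
    by apply: leq_sum => j _; rewrite !inE; case: (_ \in T); rewrite ?orbT.
  by rewrite tT; lia.
exists w => //; apply/feasibleP => S sS.
have := fD S sS; rewrite (outD1 S vwD) !(loadD1 _ _ i) /= eqxx -/v.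
have -> : \sum_(j | j != i) ((if j == i then w else b j) \in S)
        = \sum_(j | j != i) (b j \in S) by apply: eq_bigr => j /negbTE ->.
set rest := (X in _ + X); case: (boolP (w \in S)) => wS; last first.
  by rewrite /= andbT leq_add2l.
case: (boolP (v \in S)) => vS //=; rewrite !add0n => le_rest.
rewrite ltn_neqAle le_rest andbT; apply/eqP => eq_rest.
have tS : out D S = load b S.
  by rewrite (outD1 S vwD) (loadD1 b _ i) -/v (negbTE vS) /= -eq_rest.
have /maxT : tight (S :|: T).
  rewrite /tight !inE !negb_or sS sT vS vT /=.
  have leU : load b (S :|: T) <= out D (S :|: T) by rewrite fD // inE negb_or sS.
  have leI : load b (S :&: T) <= out D (S :&: T) by rewrite fD // inE negb_and sS.
  rewrite eqn_leq leU andbT -(leq_add2l (out D (S :&: T))).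
  by rewrite (leq_trans (out_submod D S T)) // tS tT -load_mod leq_add2r.
rewrite /= leqNgt => /negP; apply; apply: proper_card.
by apply/properP; split; [exact: subsetUr | exists w; rewrite // inE wS].
Qed.

(** An arc-disjoint form of Menger's theorem, by induction on [#|D|]: each push spends one arc, and
    [A i] collects the arcs spent by token [i]. *)
Lemma feasible_routing (V I : finType) (b : I -> V) (s : V) (D : {set V * V}) :
  feasible b s D ->
  exists A : I -> {set V * V},
    [/\ forall i, A i \subset D,
        forall i, connect (fun x y => (x, y) \in A i) (b i) s
      & forall i j a, a \in A i -> a \in A j -> i = j].
Proof.
have [n] := ubnP #|D|; elim: n => // n IHn in b D * => ltDn fD.
have [/forallP bs|/forallPn[i bi]] := boolP [forall i, b i == s].
  exists (fun=> set0); split=> [i|i|i j a]; rewrite ?sub0set ?inE //.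
  by rewrite (eqP (bs i)) connect0.
have [w vwD /IHn[]] := feasible_push fD bi.
  by rewrite (leq_trans _ (ltnSE ltDn)) // [X in _ < X](cardsD1 (b i, w)) vwD.
move=> A [sA cA dA].
exists (fun j => if j == i then (b i, w) |: A j else A j); split=> [j|j|].
- have sAD := subset_trans (sA j) (subsetDl _ _).
  by case: ifP => // _; rewrite subUset sub1set vwD.
- case: eqP (cA j) => // -> /= cwA.
  apply: connect_trans (_ : connect _ w s).
    by apply: connect1; rewrite /= !inE eqxx.
  apply: connect_sub cwA => x y xyA; apply: connect1.
  by rewrite /= !inE xyA orbT.
- have notA k a : a \in A k -> a != (b i, w).
    by move/(subsetP (sA k)); rewrite !inE => /andP[].
  move=> j k a; have [->|ji] := eqVneq j i; have [->|ki] := eqVneq k i => //.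
  + rewrite !inE => /orP[/eqP-> /notA|]; first by rewrite eqxx.
    exact: dA.
  + rewrite !inE => aAj /orP[/eqP aE|]; last exact: dA.
    by move/notA: aAj; rewrite aE eqxx.
  + exact: dA.
Qed.

(** * Clique immersions *)

(** [F] is the family of admissible cuts; it shrinks in the induction that contracts sets. *)
Definition inseparable (V : finType) (d : {set V} -> nat) (K : nat)
  (F : pred {set V}) (v w : V) : Prop :=
  forall A, F A -> d A < K -> (v \in A) = (w \in A).

(** Both orientations of each edge are present, so [out (arcs G) S] is the number of edges between
    [S] and its complement. *)
Definition arcs (G : sgraph) : {set G * G} := [set a | adj a.1 a.2].

Lemma out_arcsC (G : sgraph) (S : {set G}) : out (arcs G) (~: S) = out (arcs G) S.
Proof.
rewrite /out (reindex_inj (h := fun a : G * G => (a.2, a.1))) /=; last first.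
  by move=> [x y] [x' y'] [-> ->].
apply: eq_big => [[x y]|[x y] _] /=; first by rewrite !inE adj_sym.
by rewrite !inE negbK andbC.
Qed.

Lemma complete_edgeP (t : nat) (e : {set complete_graph t}) :
  reflect (exists i j : 'I_t, i != j /\ e = [set i; j])
    (e \in edges (complete_graph t)).
Proof.
apply: (iffP imsetP) => [[[i j] ij ->]|[i [j [ij ->]]]]; first by rewrite inE in ij; exists i, j.
by exists (i, j); rewrite ?inE.
Qed.

Lemma path_edges_rel (G : sgraph) (e : rel G) x (p : seq G) (f : {set G}) :
  path e x p -> f \in path_edges (x :: p) ->
  exists y z, e y z /\ f = [set y; z].
Proof.
elim: p x => //= y p IHp x /andP[exy eyp].
by rewrite /path_edges /= inE => /orP[/eqP->|/IHp]; [exists x, y | apply].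
Qed.

Lemma inseparable_immersion (G : sgraph) (t : nat) (phi : 'I_t -> G) :
  injective phi ->
  (forall i j, inseparable (out (arcs G)) ((t - 1) ^ 2) predT (phi i) (phi j)) ->
  immersion (complete_graph t) G.
Proof.
case: t phi => [|n] phi phi_inj insep.
  exists phi, (fun=> [::]); split=> // e; first by case/complete_edgeP => -[].
  by move=> f /complete_edgeP [[]].
rewrite subn1 /= in insep.
set s := phi ord_max.
(* Token [(i, j)] is the half starting at [i] of the path joining [i] to [j];
   the tokens [(i, i)] are idle. *)
pose b (p : 'I_n.+1 * 'I_n.+1) := if p.1 == p.2 then s else phi p.1.
have fb : feasible b s (arcs G).
  apply/feasibleP => S sS.
  have [/forallP noS|/forallPn[i]] := boolP [forall i, phi i \notin S].
    rewrite /load big1 // => p _; rewrite /b.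
    by case: ifP => _; rewrite ?(negbTE sS) ?(negbTE (noS _)).
  rewrite negbK => iS.
  (* Only tokens [(i, j)] with [i != ord_max] and [j != i] can lie in [S], at most [n * n] in
     all. *)
  apply: (@leq_trans (n ^ 2)); last first.
    rewrite leqNgt; apply/negP => /(insep i ord_max S isT).
    by rewrite iS -/s (negbTE sS).
  rewrite /load (eq_bigr (fun p => b (p.1, p.2) \in S : nat)); last by case.
  rewrite -(pair_bigA _ (fun i j => b (i, j) \in S : nat)) /=.
  rewrite (bigD1 ord_max) //= big1 ?add0n => [|j _]; last first.
    by rewrite /b /= if_same (negbTE sS).
  apply: (@leq_trans (\sum_(i < n.+1 | i != ord_max) n)).
    apply: leq_sum => j _; rewrite (bigD1 j) //= /b eqxx (negbTE sS) add0n.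
    apply: (@leq_trans (\sum_(k < n.+1 | k != j) 1)).
      by apply: leq_sum => k _; case: (_ \in S).
    by rewrite sum1_card cardC1 card_ord.
  by rewrite sum_nat_const cardC1 card_ord mulnn.
(* Once no two arcs of [D] are opposite, arc-disjoint routes are edge-disjoint. *)
have [D sD [fD antiD]] := feasible_antisym fb.
have [A [sA cA dA]] := feasible_routing fD.
have adjA p x y : (x, y) \in A p -> adj x y.
  by move/(subsetP (sA p))/(subsetP sD); rewrite inE.
pose link i j (x y : G) :=
  [|| (x, y) \in A (i, j), (y, x) \in A (i, j), (x, y) \in A (j, i)
    | (y, x) \in A (j, i)].
have link_sym i j : symmetric (link i j).
  by move=> x y; rewrite /link; do 4!case: (_ \in _).
have link_ends i j : i != j -> connect (link i j) (phi i) (phi j).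
  move=> ij; apply: (@connect_trans _ _ s).
    have := cA (i, j); rewrite /b /= (negbTE ij); apply: connect_sub => x y xy.
    by apply: connect1; rewrite /link xy.
  rewrite (sym_connect_sym (link_sym i j)).
  have := cA (j, i); rewrite /b /= eq_sym (negbTE ij); apply: connect_sub => x y xy.
  by apply: connect1; rewrite /link xy !orbT.
(* The last clause records which token owns each edge of a path; disjointness is read off from
   it. *)
have /fin_all_exists[P PP] : forall e : {set 'I_n.+1}, exists q : seq G,
    e \in edges (complete_graph n.+1) ->
    [/\ is_path q, endpoints q = phi @: e &
        forall f, f \in path_edges q -> exists i j x y,
          [/\ e = [set i; j], f = [set x; y] & (x, y) \in A (i, j)]].
  move=> e; have [/complete_edgeP[i [j [ij ->]]]|_] := boolP (e \in edges (complete_graph n.+1));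
    last by exists [::].
  have /connectP[p0 linkp0 lastp0] := link_ends _ _ ij.
  case/shortenP: linkp0 lastp0 => p linkp uniqp _ lastp; exists (phi i :: p) => _; split.
  - rewrite /is_path uniqp andbT; apply: sub_path linkp => x y.
    by case/or4P => /adjA //; rewrite adj_sym.
  - by rewrite imsetU !imset_set1 /= -lastp.
  - move=> f /(path_edges_rel linkp)[x [y [+ ->]]].
    case/or4P => ?; [exists i, j, x, y | exists i, j, y, x
                    | exists j, i, x, y | exists j, i, y, x];
      by split=> //; rewrite setUC.
exists phi, P; split=> // [e /PP[]//|e f eE fE].
rewrite disjoint_has; apply: contra_neqN => /hasP[g].
have [_ _ /[apply] Pe] := PP e eE; have [_ _ /[apply] Pf] := PP f fE.
move: Pe Pf => [i [j [x [y [-> -> xyA]]]]] [k [l [x' [y' [-> eq_xy xyA']]]]].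
have xyD := subsetP (sA _) _ xyA; have xyD' := subsetP (sA _) _ xyA'.
have neq_xy : x != y.
  by apply: contraTneq (adjA _ _ _ xyA) => ->; rewrite adj_irr.
suff [xx' yy'] : x = x' /\ y = y'.
  by rewrite -xx' -yy' in xyA'; have [-> ->] := dA _ _ _ xyA xyA'.
have : x \in [set x'; y'] by rewrite -eq_xy set21.
have : y \in [set x'; y'] by rewrite -eq_xy set22.
rewrite !inE => /orP[]/eqP yE /orP[]/eqP xE; subst x y; rewrite ?eqxx // in neq_xy *.
by have /negP := antiD _ _ neq_xy xyD.
Qed.

(** * Ranking the classes by uncrossing cuts *)

Definition setI_stable (V : finType) (F : pred {set V}) : Prop :=
  (forall A, F A -> F (~: A)) /\ (forall A B, F A -> F B -> F (A :&: B)).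

(* The cuts of [F] that survive when [S] is contracted to a point. *)
Definition contract (V : finType) (S : {set V}) (F : pred {set V}) : pred {set V} :=
  fun A => F A && ((S \subset A) || (S \subset ~: A)).

Lemma contract_stable (V : finType) (S : {set V}) (F : pred {set V}) :
  setI_stable F -> setI_stable (contract S F).
Proof.
move=> [FC FI]; split=> [A /andP[FA SA]|A B /andP[FA SA] /andP[FB SB]].
  by rewrite /contract FC // setCK orbC.
rewrite /contract FI //= subsetI setCI.
case/orP: SA => [->|SA]; last first.
  by rewrite [X in _ || X](subset_trans SA) ?orbT // subsetUl.
case/orP: SB => [->//|SB].
by rewrite [X in _ || X](subset_trans SB) ?orbT // subsetUr.
Qed.

Lemma stableU (V : finType) (F : pred {set V}) A B :
  setI_stable F -> F A -> F B -> F (A :|: B).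
Proof.
by move=> [FC FI] FA FB; rewrite -[_ :|: _]setCK setCU; apply/FC/FI; apply: FC.
Qed.

(** [S] is a minimum cut dividing [Q]. If [z] is outside [A], then [A :|: S] separates [v] from [z],
    so it costs at least [d S], and submodularity gives [d (A :&: S) <= d A]. The set [A :&: S]
    survives the contraction and splits [v] and [w] exactly when [A] does. *)
Lemma uncross_inseparable (V : finType) (d : {set V} -> nat) (K : nat)
    (dC : forall A, d (~: A) = d A)
    (dS : forall A B, d (A :&: B) + d (A :|: B) <= d A + d B)
    (F : pred {set V}) (Q S : {set V}) z v w :
  setI_stable F -> F S ->
  (forall A x y, F A -> x \in Q -> y \in Q -> x \in A -> y \notin A ->
    d S <= d A) ->
  z \in Q -> z \notin S -> v \in Q -> w \in Q -> v \in S -> w \in S ->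
  inseparable d K (contract (~: S) F) v w -> inseparable d K F v w.
Proof.
move=> stF FS minS zQ zS vQ wQ vS wS insep A.
have [FC FI] := stF.
wlog zA : A / z \notin A.
  move=> IH FA ltA; have [zA|/IH->//] := boolP (z \in A).
  have := IH (~: A); rewrite !inE negbK zA dC => /(_ isT (FC _ FA) ltA).
  by move/negb_inj.
move=> FA ltA.
have ltI : d (A :&: S) < K.
  apply: leq_ltn_trans ltA; rewrite -(leq_add2r (d S)).
  apply: leq_trans (dS A S); rewrite leq_add2l.
  by apply: (minS _ v z); rewrite ?inE ?vS ?orbT ?negb_or ?zA //; apply: stableU.
have := insep (A :&: S); rewrite !inE vS wS !andbT; apply=> //.
by rewrite /contract FI //= setCS subsetIr orbT.
Qed.

(** Uncrossing replaces [A] by [A :|: S] if [A] meets [Q :&: S], and by [A :&: ~: S] otherwise. In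
    both cases the other set in the submodular inequality still divides [Q], so it costs at least
    [d S]. *)
Lemma uncross_separation (V : finType) (d : {set V} -> nat) (K : nat)
    (dC : forall A, d (~: A) = d A)
    (dS : forall A B, d (A :&: B) + d (A :|: B) <= d A + d B)
    (F : pred {set V}) (Q S : {set V}) r v (A : {set V}) :
  setI_stable F -> F S -> r \notin S ->
  (forall A x y, F A -> x \in Q -> y \in Q -> x \in A -> y \notin A ->
    d S <= d A) ->
  Q :&: S != set0 -> v \in Q -> v \notin S ->
  F A -> v \in A -> r \notin A -> d A < K ->
  exists2 B, contract S F B & [/\ v \in B, r \notin B & d B < K].
Proof.
move=> stF FS rS minS /set0Pn[z /setIP[zQ zS]] vQ vS FA vA rA ltA.
have [FC FI] := stF.
have [/existsP[y /and3P[yQ yS yA]]|/existsPn noQ] :=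
  boolP [exists y, [&& y \in Q, y \in S & y \in A]].
  exists (A :|: S); first by rewrite /contract stableU //= subsetUr.
  rewrite !inE vA negb_or rA rS; split=> //; apply: leq_ltn_trans ltA.
  rewrite -(leq_add2l (d S)) [leqRHS]addnC; apply: leq_trans (dS A S).
  rewrite leq_add2r; apply: (minS _ y v) => //; rewrite ?inE ?yS ?yA ?(negbTE vS) ?andbF //.
  exact: FI.
exists (A :&: ~: S).
  by rewrite /contract FI ?FC //= setCI setCK subsetUr orbT.
rewrite !inE vA vS (negbTE rA); split=> //; apply: leq_ltn_trans ltA.
rewrite -(leq_add2r (d S)) -[d S in leqRHS]dC; apply: leq_trans (dS A (~: S)).
rewrite leq_add2l -[leqRHS]dC; apply: (minS _ z v) => //.
- by apply/FC/stableU/FC.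
- by have := noQ z; rewrite zQ zS !inE zS orbF.
- by rewrite !inE vA.
Qed.

(** Induction on [#|Q|]: split [Q] along a minimum cut [S] avoiding [r], contract each side in turn,
    and rank the vertices inside [S] above those outside. Cuts found for vertices inside [S] stay
    inside [S]; those for vertices outside may swallow [S], where ranks are higher. *)
Lemma cut_ranking (V : finType) (d : {set V} -> nat) (K : nat)
    (dC : forall A, d (~: A) = d A)
    (dS : forall A B, d (A :&: B) + d (A :|: B) <= d A + d B)
    (F : pred {set V}) (Q : {set V}) (r : V) :
  setI_stable F ->
  (forall v, v \in Q -> exists2 A, F A & [/\ v \in A, r \notin A & d A < K]) ->
  exists (rk : V -> nat) (S : V -> {set V}), forall v, v \in Q ->
    [/\ v \in S v, r \notin S v, F (S v), d (S v) < K &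
      forall w, w \in Q -> w \in S v ->
        rk v <= rk w /\ (rk v = rk w -> inseparable d K F v w)].
Proof.
have [n] := ubnP #|Q|; elim: n => // n IHn in F Q * => ltQn stF sepr.
have [FC FI] := stF.
pose cuts A := [&& F A, d A < K & [exists x in Q, [exists y in Q, (x \in A) && (y \notin A)]]].
have [/existsP[S0 cutS0]|/existsPn nocut] := boolP [exists A, cuts A]; last first.
  have /fin_all_exists[S PS] : forall v, exists A : {set V}, v \in Q ->
      [/\ v \in A, r \notin A, F A & d A < K].
    move=> v; have [/sepr[A FA [vA rA ltA]]|_] := boolP (v \in Q).
      by exists A.
    by exists set0.
  exists (fun=> 0), S => v vQ; have [vS rS FS ltS] := PS v vQ; split=> // w wQ _.
  split=> // _ A FA ltA; have := nocut A; rewrite /cuts FA ltA => /exists_inPn noA.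
  have sepA x y : x \in Q -> y \in Q -> x \in A -> y \in A.
    by move=> /noA/exists_inPn/[apply]; rewrite negb_and negbK => /orP[/negbTE->|].
  by apply/idP/idP; apply: sepA.
have [S [cutS rS]] : exists S, [/\ cuts S, r \notin S & forall A, cuts A -> d S <= d A].
  case: (arg_minnP d cutS0) => S cutS minS.
  have [rS|rS] := boolP (r \in S); last by exists S.
  exists (~: S); rewrite inE rS dC; split=> //; case/and3P: cutS => FS ltS.
  move=> /exists_inP[x xQ /exists_inP[y yQ /andP[xS yS]]].
  rewrite /cuts FC // dC ltS; apply/exists_inP; exists y => //.
  by apply/exists_inP; exists x; rewrite // !inE xS yS.
case/and3P: cutS => FS ltS /exists_inP[x xQ /exists_inP[y yQ /andP[xS yS]]] minS0.
(* Cuts of size at least [K] cost more than [d S] anyway. *)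
have minS (A : {set V}) u w : F A -> u \in Q -> w \in Q -> u \in A -> w \notin A -> d S <= d A.
  move=> FA uQ wQ uA wA; have [ltA|leA] := ltnP (d A) K; last first.
    exact: leq_trans (ltnW ltS) leA.
  apply: minS0; rewrite /cuts FA ltA; apply/exists_inP; exists u => //.
  by apply/exists_inP; exists w; rewrite // uA.
have QS0 : Q :&: S != set0 by apply/set0Pn; exists x; rewrite inE xQ.
have [||v|rk1 [S1 P1]] := IHn (contract S F) (Q :\: S).
- rewrite (leq_trans _ (ltnSE ltQn)) // proper_card //.
  by apply/properP; split; [exact: subsetDl | exists x; rewrite // inE xS].
- exact: contract_stable.
- rewrite inE => /andP[vS vQ]; have [A FA [vA rA ltA]] := sepr v vQ.
  exact: (uncross_separation dC dS stF FS rS minS QS0 vQ vS FA).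
have [||v|rk2 [S2 P2]] := IHn (contract (~: S) F) (Q :&: S).
- rewrite (leq_trans _ (ltnSE ltQn)) // proper_card //.
  by apply/properP; split; [exact: subsetIl | exists y; rewrite // inE (negbTE yS) andbF].
- exact: contract_stable.
- rewrite inE => /andP[vQ vS]; exists S => //.
  by rewrite /contract FS subxx orbT.
pose N := (\max_v rk1 v).+1.
have ltN v : rk1 v < N by rewrite ltnS leq_bigmax.
exists (fun v => if v \in S then N + rk2 v else rk1 v),
       (fun v => if v \in S then S2 v else S1 v) => v vQ.
have [vS|vS] := boolP (v \in S).
  have [|vS2 rS2 /andP[FS2 S2S] ltS2 P] := P2 v; first by rewrite inE vQ.
  (* [S2 v] does not cross [~: S] and misses [r], which lies in [~: S]. *)
  have {}S2S : S2 v \subset S.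
    case/orP: S2S => [/subsetP/(_ r)|]; last by rewrite setCS.
    by rewrite inE rS (negbTE rS2) => /(_ isT).
  split=> // w wQ wS2; have wS := subsetP S2S w wS2; rewrite wS leq_add2l.
  have [||? insep] := P w; rewrite ?inE ?wQ //; split=> // /addnI/insep.
  exact: (uncross_inseparable (K := K) dC dS stF FS minS yQ yS vQ wQ vS wS).
have [|vS1 rS1 /andP[FS1 _] ltS1 P] := P1 v; first by rewrite inE vQ vS.
split=> // w wQ wS1; case: (boolP (w \in S)) => wS.
  have lt_rk : rk1 v < N + rk2 w by rewrite (leq_trans (ltN v)) ?leq_addr.
  by split; [exact: ltnW | move=> eq_rk; rewrite eq_rk ltnn in lt_rk].
have [||? insep] := P w; rewrite ?inE ?wQ ?wS //; split=> // /insep.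
rewrite -{1}[S]setCK; apply: (uncross_inseparable dC dS (Q := Q) (z := x)) => //; rewrite ?inE ?negbK ?FC //.
by move=> A u u' FA uQ u'Q uA u'A; rewrite dC; apply: minS uA u'A.
Qed.

(** The class of [r] comes first, with the whole vertex set as its cut, whence [dT]; [cut_ranking]
    handles the vertices separable from [r]. *)
Lemma class_ranking (V : finType) (d : {set V} -> nat) (K : nat)
    (dC : forall A, d (~: A) = d A)
    (dS : forall A B, d (A :&: B) + d (A :|: B) <= d A + d B)
    (dT : d setT < K) (r : V) :
  exists (rk : V -> nat) (S : V -> {set V}),
    [/\ forall v, v \in S v /\ d (S v) < K,
        forall v w, w \in S v -> rk v <= rk w
      & forall v w, rk v = rk w <-> inseparable d K predT v w].
Proof.
pose insep v w := [forall A : {set V}, (d A < K) ==> ((v \in A) == (w \in A))].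
have insepP v w : reflect (inseparable d K predT v w) (insep v w).
  apply: (iffP forallP) => [h A _ ltA|h A]; first exact: eqP (implyP (h A) ltA).
  by apply/implyP => ltA; rewrite (h A).
have [|v|rk0 [S0 P0]] :=
  cut_ranking dC dS (K := K) (F := predT) (Q := [set v | ~~ insep r v]) (r := r).
- by [].
- rewrite inE => /forallPn[A]; rewrite negb_imply => /andP[ltA].
  case rA : (r \in A); case vA: (v \in A) => // _.
    by exists (~: A) => //; rewrite !inE rA vA dC.
  by exists A => //; rewrite rA.
pose rk1 v := if insep r v then 0 else (rk0 v).+1.
pose S1 v := if insep r v then setT else S0 v.
have S1P v : v \in S1 v /\ d (S1 v) < K.
  rewrite /S1; case: ifP => [|rv]; first by rewrite inE.
  by have [] := P0 v; rewrite // inE rv.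
have S1rk v w : w \in S1 v -> rk1 v <= rk1 w /\ (rk1 v = rk1 w -> insep v w).
  rewrite /S1 /rk1; case: ifP => [/insepP rv _|/negbT rv wS].
    split=> //; case: ifP => // /insepP rw _.
    by apply/insepP => A FA ltA; rewrite -rv // rw.
  have [|vS rS _ ltS P] := P0 v; first by rewrite inE.
  case: ifP => [/insepP/(_ _ isT ltS)|/negbT rw].
    by rewrite wS (negbTE rS).
  have [||le_rk eq_rk] := P w; rewrite ?inE //.
  by split=> // -[/eq_rk/insepP].
(* [pick] sees only the predicate [insep v], so inseparable vertices get the same representative. *)
pose rep v := odflt v [pick w | insep v w].
have insep_rep v : insep v (rep v).
  by rewrite /rep; case: pickP => //= _; apply/insepP.
have rep_eq v w : insep v w -> rep v = rep w.
  move=> /insepP vw; rewrite /rep (@eq_pick _ _ (insep w)); last first.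
    by move=> u; apply/insepP/insepP => h A FA ltA; rewrite -h // vw.
  by case: pickP => //= /(_ w) /insepP[].
pose N := #|V|.
(* Breaking ties by representative makes the rank injective on classes. *)
pose rk v := rk1 (rep v) * N + enum_rank (rep v).
exists rk, (fun v => S1 (rep v)); split=> [v|v w wS|v w].
- have [vS ltS] := S1P (rep v); split=> //.
  by rewrite (insepP _ _ (insep_rep v)).
- have repwS : rep w \in S1 (rep v).
    by rewrite -(insepP _ _ (insep_rep w)) //; have [] := S1P (rep v).
  have [+ eq_rk] := S1rk _ _ repwS; rewrite leq_eqVlt => /orP[/eqP/eq_rk|lt_rk].
    move=> /rep_eq; rewrite /rk.
    by rewrite -!(rep_eq _ _ (insep_rep _)) => ->.
  rewrite /rk; have := ltn_ord (enum_rank (rep v)).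
  rewrite -/N; nia.
- split=> [eq_rk|/insepP/rep_eq]; last by rewrite /rk => ->.
  have eq_rep : rep v = rep w.
    apply/enum_rank_inj/val_inj; have := congr1 (modn^~ N) eq_rk.
    by rewrite /rk !modnMDl !modn_small.
  move=> A FA ltA; rewrite (insepP _ _ (insep_rep v)) // eq_rep.
  by rewrite -(insepP _ _ (insep_rep w)).
Qed.

(** * Colouring the classes and bounding the defect *)

Lemma alternating_colour (g : nat -> nat) :
  exists col : nat -> bool, forall n, g n < n -> col n = ~~ col (g n).
Proof.
(* [k] is fuel: the argument strictly decreases along the calls that matter, so every [k] above [n]
   gives the same value. *)
pose f := fix f k n {struct k} := if k is k'.+1 then (g n < n) && ~~ f k' (g n) else true.
have f_fuel k l n : n < k -> n < l -> f k n = f l n.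
  elim: k l n => // k IHk [//|l] n nk nl /=; case: ltnP => //= gn.
  by rewrite (IHk l) ?(leq_trans gn).
exists (fun n => f n.+1 n) => n gn /=; rewrite gn /=.
by congr (~~ _); apply: (f_fuel n (g n).+1).
Qed.

Lemma card_bigcup_leq (T I : finType) (A : {set I}) (B : I -> {set T}) m :
  (forall i, i \in A -> #|B i| <= m) -> #|\bigcup_(i in A) B i| <= #|A| * m.
Proof.
move=> leB; rewrite -sum_nat_const.
elim/big_ind2: _ => [|C1 n1 C2 n2 le1 le2|i /leB//]; first by rewrite cards0.
by rewrite (leq_trans (leq_card_setU _ _)) // leq_add.
Qed.

Theorem theorem31 (t : nat) (ht : 1 <= t) (G : sgraph)
  (hG : ~ immersion (complete_graph t) G) :
  colourable_with_defect 2 ((t - 1) ^ 3) G.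
Proof.
have [/existsP[r _]|/existsPn noV] := boolP [exists r : G, true]; last first.
  by exists (fun=> ord0) => v; have := noV v.
(* For [t = 1], the single vertex [r] already gives an immersion. *)
have t_gt1 : 1 < t.
  rewrite ltn_neqAle ht andbT; apply/eqP => t1; apply: hG; rewrite -t1.
  exists (fun=> r), (fun=> [::]); split=> [i j _||]; first by rewrite !ord1.
    by move=> e /complete_edgeP[i [j []]]; rewrite !ord1.
  by move=> e f /complete_edgeP[i [j []]]; rewrite !ord1.
have outT : out (arcs G) setT < (t - 1) ^ 2.
  rewrite /out big1; first by rewrite expn_gt0 subn_gt0 t_gt1.
  by move=> a _; rewrite !inE.
have [rk [S [SP Srk rkP]]] :=
  class_ranking (@out_arcsC G) (out_submod (arcs G)) outT r.
have small v : #|[set w | rk w == rk v]| <= t - 1.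
  rewrite leqNgt; apply/negP => large; apply: hG.
  have let_ : t <= #|[set w | rk w == rk v]| by lia.
  apply: (@inseparable_immersion G t (fun i => enum_val (widen_ord let_ i))).
    by move=> i j /enum_val_inj/(congr1 val)/= /val_inj.
  move=> i j; apply/rkP.
  have := enum_valP (widen_ord let_ i); have := enum_valP (widen_ord let_ j).
  by rewrite !inE => /eqP-> /eqP->.
(* Below, [find (nbr j) (iota 0 j)] is the least rank of a neighbour of class
   [j], or [j] if that rank is at least [j]. *)
pose nbr j m := [exists a in arcs G, (rk a.1 == j) && (rk a.2 == m)].
have [col colP] := alternating_colour (fun j => find (nbr j) (iota 0 j)).
exists (fun v => if col (rk v) then ord0 else ord_max) => v.
set C := [set w | _ & _].
pose X := [set w | rk w == rk v].
pose cut := [set a in arcs G | (a.1 \in S v) && (a.2 \notin S v)].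
(* An arc leaving [S v] accounts for its head if its tail is in the class of [v], and for the whole
   class of its tail otherwise: at most [t - 1] vertices either way. *)
pose B (a : G * G) :=
  if rk a.1 == rk v then [set a.2] else [set w | rk w == rk a.1].
have sC : C \subset (X :\ v) :|: \bigcup_(a in cut) B a.
  apply/subsetP => w; rewrite !inE => /andP[vw /eqP cw].
  have neq_wv : w != v by apply: contraTneq vw => ->; rewrite adj_irr.
  rewrite neq_wv; have [//|neq_rk /=] := eqVneq (rk w) (rk v).
  have {}cw : col (rk w) = col (rk v).
    by move: cw; case: (col (rk w)); case: (col (rk v)) => // /(congr1 val).
  apply/bigcupP; have [wS|wS] := boolP (w \in S v); last first.
    exists (v, w); last by rewrite /B eqxx set11.
    by rewrite !inE vw wS andbT; have [] := SP v.
  have lt_rk : rk v < rk w by rewrite ltn_neqAle eq_sym neq_rk Srk.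
  have nbr_v : nbr (rk w) (rk v).
    by apply/exists_inP; exists (w, v); rewrite ?inE ?eqxx //= adj_sym.
  have le_m : find (nbr (rk w)) (iota 0 (rk w)) <= rk v.
    rewrite leqNgt; apply/negP => /(before_find 0).
    by rewrite nth_iota // add0n nbr_v.
  have lt_m := leq_ltn_trans le_m lt_rk.
  have /exists_inP[[u z] uz /andP[/eqP/= uw /eqP/= zm]] :
      nbr (rk w) (find (nbr (rk w)) (iota 0 (rk w))).
    have := nth_find 0 (a := nbr (rk w)) (s := iota 0 (rk w)).
    by rewrite has_find size_iota nth_iota // add0n => /(_ lt_m).
  (* If the least neighbouring rank were [rk v], the class of [w] would have the colour opposite to
     that of [v]. *)
  have neq_m : find (nbr (rk w)) (iota 0 (rk w)) != rk v.
    by apply/eqP => eq_m; have := colP _ lt_m; rewrite eq_m cw; case: (col _).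
  (* [u] is inseparable from [w], hence in [S v], while [z] has rank below [rk v], hence is
     outside. *)
  exists (u, z); last by rewrite /B /= uw (negbTE neq_rk) inE.
  rewrite inE uz /=; apply/andP; split.
    have /rkP/(_ (S v) isT) -> // := uw; by have [] := SP v.
  by apply/negP => /Srk; rewrite zm leqNgt ltn_neqAle neq_m le_m.
apply: leq_trans (subset_leq_card sC) _; apply: leq_trans (leq_card_setU _ _) _.
have leX : #|X :\ v| < t - 1.
  by have := small v; rewrite [X in X <= _](cardsD1 v) inE eqxx.
have leB : #|\bigcup_(a in cut) B a| <= #|cut| * (t - 1).
  by apply: card_bigcup_leq => a _; rewrite /B; case: ifP => // _; rewrite cards1 subn_gt0.
have ltcut : #|cut| < (t - 1) ^ 2.
  by have [_] := SP v; rewrite outE.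
have := leq_mul ltcut (leqnn (t - 1)); rewrite -expnSr mulSn; lia.
Qed.
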